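(* Let $m$ and $n$ be positive integers. If there is an expression of the integer $m$ using exactly $n$ $1$s, then there exists a graph on $n$ vertices with exactly $m$ maximal independent sets.
   Context: All graphs are finite, simple and undirected. A set $I$ of vertices of a graph $G$ is independent if there is no edge between any two vertices of $I$; it is a maximal independent set if it is not properly contained in any other independent set of $G$. An expression of a positive integer $m$ with $n$ $1$s is an arithmetic expression with value $m$ built from exactly $n$ occurrences of the symbol $1$ using only addition $+$, multiplication $\cdot$, and parentheses. Equivalently, expressions are defined recursively: $1$ is an expression of the integer $1$ with one $1$; and if $e_1$ is an expression of $m_1$ with $n_1$ $1$s and $e_2$ is an expression of $m_2$ with $n_2$ $1$s, then $(e_1+e_2)$ and $(e_1\cdot e_2)$ are expressions of $m_1+m_2$ and $m_1m_2$, respectively, each with $n_1+n_2$ $1$s. *)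

(* Defs.v *)
From mathcomp Require Import all_boot.

Set Implicit Arguments.
Unset Strict Implicit.
Unset Printing Implicit Defensive.

Inductive expr : Type :=
  | One
  | Add of expr & expr
  | Mul of expr & expr.

Fixpoint value (a : expr) : nat :=
  match a with
  | One => 1
  | Add a1 a2 => value a1 + value a2
  | Mul a1 a2 => value a1 * value a2
  end.

Fixpoint ones (a : expr) : nat :=
  match a with
  | One => 1
  | Add a1 a2 | Mul a1 a2 => ones a1 + ones a2
  end.

Record sgraph : Type := SGraph {
  vertex : finType;
  edge : rel vertex;
  edge_sym : symmetric edge;
  edge_irrefl : irreflexive edge
}.

Definition independent (G : sgraph) (I : {set vertex G}) : bool :=
  [forall x in I, forall y in I, ~~ edge x y].

Definition maximal_independent_sets (G : sgraph) : {set {set vertex G}} :=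
  [set I | maxset (@independent G) I].

(* Main.v *)
(* By induction on the expression: 1 is realised by the one-vertex graph, a sum
   by the join of two graphs and a product by their disjoint union.  A maximal
   independent set of a disjoint union is a pair of maximal independent sets,
   one per part; a maximal independent set of a join lies in one of the two
   parts, and maximal independent sets of nonempty graphs are nonempty, so
   those of the two parts are counted separately. *)
Require Import Defs.
From mathcomp Require Import all_boot.

Set Implicit Arguments.
Unset Strict Implicit.
Unset Printing Implicit Defensive.

Definition no_neighbor (G : sgraph) (I : {set vertex G}) (x : vertex G) : bool :=
  [forall y in I, ~~ edge x y].

(* Maximal independent sets are the fixed points of [no_neighbor]; this local
   form decomposes over the vertices of a join or a disjoint union. *)
Lemma mem_maximal_independent_sets (G : sgraph) (I : {set vertex G}) :
  (I \in maximal_independent_sets G) = [forall x, (x \in I) == no_neighbor I x].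
Proof.
rewrite inE; apply/maxsetP/forallP => [[indI maxI] x|fixI]; last first.
  split=> [|J indJ sIJ].
    apply/forall_inP => x xI; apply/forall_inP => y yI.
    by move: xI; rewrite (eqP (fixI x)) => /forall_inP; apply.
  apply/eqP; rewrite eqEsubset sIJ andbT; apply/subsetP => x xJ.
  rewrite (eqP (fixI x)); apply/forall_inP => y /(subsetP sIJ) yJ.
  exact: (forall_inP (forall_inP indJ x xJ)).
apply/eqP; apply/idP/idP => [xI|nbx]; first exact: (forall_inP indI x xI).
(* Adding to [I] a vertex with no neighbor in [I] keeps it independent, so maximality forces
   [x |: I = I]. *)
rewrite -(maxI (x |: I)) ?subsetUr ?setU11 //.
apply/forall_inP => y /setU1P yI; apply/forall_inP => z /setU1P zI.
case: yI zI => [->|yI] [->|zI]; first by rewrite edge_irrefl.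
- exact: (forall_inP nbx).
- by rewrite edge_sym (forall_inP nbx).
- exact: (forall_inP (forall_inP indI y yI)).
Qed.

(** Any vertex vacuously has no neighbor in [set0], so [set0] is not a fixed point. *)
Lemma maximal_independent_neq0 (G : sgraph) (I : {set vertex G}) :
  0 < #|vertex G| -> I \in maximal_independent_sets G -> I != set0.
Proof.
case/card_gt0P => x _; rewrite mem_maximal_independent_sets => /forallP/(_ x).
apply: contraTneq => ->; rewrite inE eq_sym eqbF_neg negbK.
by apply/forall_inP => y; rewrite inE.
Qed.

(** Sets of vertices of a join or union are handled as pairs of sets, so that they can be counted by
    cardinals of products. *)
Definition sum_set (T1 T2 : finType) (p : {set T1} * {set T2}) : {set T1 + T2} :=
  [set z | match z with inl x => x \in p.1 | inr y => y \in p.2 end].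

Lemma sum_setK (T1 T2 : finType) :
  cancel (@sum_set T1 T2) (fun I => (inl @^-1: I, inr @^-1: I)).
Proof. by case=> I1 I2; congr (_, _); apply/setP => x; rewrite !inE. Qed.

Lemma preim_sumK (T1 T2 : finType) :
  cancel (fun I : {set T1 + T2} => (inl @^-1: I, inr @^-1: I)) (@sum_set T1 T2).
Proof. by move=> I; apply/setP => -[x|y]; rewrite !inE. Qed.

Lemma forall_sum_set (T1 T2 : finType) (p : {set T1} * {set T2})
    (P : pred (T1 + T2)) :
  [forall z in sum_set p, P z] =
  [forall x in p.1, P (inl x)] && [forall y in p.2, P (inr y)].
Proof.
apply/forall_inP/andP => [allP|[/forall_inP P1 /forall_inP P2] [x|y]].
- by split; apply/forall_inP => z zp; apply: allP; rewrite inE.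
- by rewrite inE; apply: P1.
- by rewrite inE; apply: P2.
Qed.

(** Adjacency between the two parts is constant, so the condition a vertex imposes on the opposite
    part has this form. *)
Lemma forall_in_const (T : finType) (A : {set T}) (b : bool) :
  [forall x in A, b] = b || (A == set0).
Proof.
case: b => /=; first by apply/forall_inP.
apply/forall_inP/eqP => [A0|-> x]; last by rewrite inE.
by apply/setP => x; rewrite inE; apply/negP => /A0.
Qed.

Definition sum_edge (b : bool) (G1 G2 : sgraph) : rel (vertex G1 + vertex G2) :=
  fun z t => match z, t with
  | inl x, inl y => edge x y
  | inr x, inr y => edge x y
  | _, _ => b
  end.

Lemma sum_edge_sym b G1 G2 : symmetric (@sum_edge b G1 G2).
Proof. by move=> [x|x] [y|y] //=; rewrite edge_sym. Qed.

Lemma sum_edge_irrefl b G1 G2 : irreflexive (@sum_edge b G1 G2).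
Proof. by move=> [x|x] /=; rewrite edge_irrefl. Qed.

(* The join of [G1] and [G2] if [b] holds, else their disjoint union. *)
Definition sum_graph (b : bool) (G1 G2 : sgraph) : sgraph :=
  SGraph (@sum_edge_sym b G1 G2) (@sum_edge_irrefl b G1 G2).

(** A vertex has no neighbor in [sum_set p] iff it has none in its own part and, for a join, the
    other component is empty. *)
Lemma mem_mis_sum_graph b G1 G2 (p : {set vertex G1} * {set vertex G2}) :
  (sum_set p \in maximal_independent_sets (sum_graph b G1 G2)) =
  [forall x, (x \in p.1) == no_neighbor p.1 x && (b ==> (p.2 == set0))] &&
  [forall y, (y \in p.2) == no_neighbor p.2 y && (b ==> (p.1 == set0))].
Proof.
have nbE z : @no_neighbor (sum_graph b G1 G2) (sum_set p) z =
    match z with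
    | inl x => no_neighbor p.1 x && (b ==> (p.2 == set0))
    | inr y => no_neighbor p.2 y && (b ==> (p.1 == set0))
    end.
  rewrite /no_neighbor forall_sum_set /=.
  by case: z => [x|y]; rewrite forall_in_const implybE // andbC.
rewrite (@mem_maximal_independent_sets (sum_graph b G1 G2)); apply/forallP/andP => [fixp|[]].
  by split; apply/forallP => x; [move: (fixp (inl x)) | move: (fixp (inr x))];
    rewrite nbE inE.
by move=> /forallP fix1 /forallP fix2 [x|y]; rewrite nbE inE.
Qed.

Lemma card_mis_sum_graph b G1 G2 :
  #|maximal_independent_sets (sum_graph b G1 G2)| =
  #|[set p | sum_set p \in maximal_independent_sets (sum_graph b G1 G2)]|.
Proof.
rewrite -(card_imset _ (can_inj (@sum_setK (vertex G1) (vertex G2)))).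
apply: eq_card => I; rewrite -[I]preim_sumK.
by rewrite (mem_imset _ _ (can_inj (@sum_setK _ _))) in_set.
Qed.

(** For [b = false] the conditions on the two components decouple. *)
Lemma card_mis_disjoint_union G1 G2 :
  #|maximal_independent_sets (sum_graph false G1 G2)| =
  #|maximal_independent_sets G1| * #|maximal_independent_sets G2|.
Proof.
rewrite card_mis_sum_graph -cardsX; apply: eq_card => -[I1 I2].
rewrite in_set mem_mis_sum_graph in_setX !mem_maximal_independent_sets.
by congr (_ && _); apply: eq_forallb => x; rewrite andbT.
Qed.

Lemma card_mis_join G1 G2 : 0 < #|vertex G1| -> 0 < #|vertex G2| ->
  #|maximal_independent_sets (sum_graph true G1 G2)| =
  #|maximal_independent_sets G1| + #|maximal_independent_sets G2|.
Proof.
move=> G1_gt0 G2_gt0.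
set M1 := maximal_independent_sets G1; set M2 := maximal_independent_sets G2.
have M1_neq0 I : I \in M1 -> I != set0 by exact: maximal_independent_neq0.
have M2_neq0 I : I \in M2 -> I != set0 by exact: maximal_independent_neq0.
(* Here [b] will say that the other component is empty; if it is not, no vertex of this part can
   belong to the set. *)
have fixE (G : sgraph) (I : {set vertex G}) b :
    [forall x, (x \in I) == no_neighbor I x && b] =
    if b then I \in maximal_independent_sets G else I == set0.
  case: b; first by rewrite mem_maximal_independent_sets;
    apply: eq_forallb => x; rewrite andbT.
  apply/forallP/eqP => [I0|-> x]; last by rewrite inE andbF.
  by apply/setP => x; rewrite (eqP (I0 x)) inE andbF.
have -> : #|maximal_independent_sets (sum_graph true G1 G2)| =
    #|setX M1 [set set0] :|: setX [set set0] M2|.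
  rewrite card_mis_sum_graph; apply: eq_card => -[I1 I2].
  rewrite in_set mem_mis_sum_graph in_setU !in_setX !in_set1 /=.
  move: (M1_neq0 I1) (M2_neq0 I2); rewrite !fixE -/M1 -/M2.
  (* The two sides could differ only when both components are empty, and then neither is maximal
     independent. *)
  case: (I1 == set0); case: (I2 == set0); case: (I1 \in M1);
    case: (I2 \in M2) => //= M1I M2I; by [have := M1I isT | have := M2I isT].
rewrite cardsU !cardsX !cards1 muln1 mul1n.
(* A common pair would have [set0] as a first component lying in [M1]. *)
rewrite (_ : _ :&: _ = set0) ?cards0 ?subn0 //.
apply/setP => -[I1 I2]; rewrite in_setI !in_setX !in_set1 in_set0 /=; apply/negP.
by case/andP => /andP[/M1_neq0/negPf-> _].
Qed.

Lemma edgeless_sym (T : finType) : symmetric (fun _ _ : T => false).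
Proof. by []. Qed.

Lemma edgeless_irrefl (T : finType) : irreflexive (fun _ _ : T => false).
Proof. by []. Qed.

Definition edgeless (T : finType) : sgraph :=
  SGraph (@edgeless_sym T) (@edgeless_irrefl T).

Lemma card_mis_edgeless (T : finType) :
  #|maximal_independent_sets (edgeless T)| = 1.
Proof.
rewrite (_ : maximal_independent_sets _ = [set setT]) ?cards1 //.
apply/setP => I; rewrite mem_maximal_independent_sets !inE.
have nb x : @no_neighbor (edgeless T) I x by apply/forall_inP.
apply/forallP/eqP => [fixI|-> x].
  by apply/setP => x; rewrite (eqP (fixI x)) nb inE.
by rewrite inE eq_sym; apply/eqP/forall_inP.
Qed.

(** This supplies the nonempty parts that counting in a join requires. *)
Lemma ones_gt0 (a : expr) : 0 < ones a.
Proof. by elim: a => //= a1 a1_gt0 a2 _; rewrite addn_gt0 a1_gt0. Qed.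

Theorem proposition9 (m n : nat) (m_gt0 : 0 < m) (n_gt0 : 0 < n) :
  (exists a : expr, value a = m /\ ones a = n) ->
  exists G : sgraph,
    #|vertex G| = n /\ #|maximal_independent_sets G| = m.
Proof.
case=> a [<- <-].
elim: a => [|a1 [G1 [V1 M1]] a2 [G2 [V2 M2]]|a1 [G1 [V1 M1]] a2 [G2 [V2 M2]]].
- by exists (edgeless unit); rewrite card_mis_edgeless card_unit.
- exists (sum_graph true G1 G2); rewrite card_sum V1 V2.
  by rewrite card_mis_join ?M1 ?M2 // ?V1 ?V2 ones_gt0.
- exists (sum_graph false G1 G2); rewrite card_sum V1 V2.
  by rewrite card_mis_disjoint_union M1 M2.
Qed.
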